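(* Let $n\ge1$ and let $F$ be a facet of Simion's type $B$ associahedron $\Gamma_n^B$. Then $F$ contains exactly one diameter; let it be $\{k,\overline{k}\}$ ($1\le k\le n+1$), so that the arrow representation of $F$ contains $(k-1,k)$ if $k\ge2$, resp. $(n+1,1)$ if $k=1$. Then the simplex spanned by the arrows representing the elements of $F$ is contained in $\zeta^{k-1}(P_n^+)$. Equivalently, this simplex is contained in $\zeta^{k-1}(P_n^+)$ exactly when $F$ contains the diameter $\{k,\overline{k}\}$.
   Context: Label the vertices of a regular $(2n+2)$-gon clockwise by $1,\ldots,n+1,\overline{1},\ldots,\overline{n+1}$. A $B$-diagonal is either a diameter $\{i,\overline{i}\}$ ($1\le i\le n+1$), or an antipodal pair of diagonals $\{\{i,j\},\{\overline{i},\overline{j}\}\}$ with $1\le i<i+1<j\le n+1$, or $\{\{i,\overline{j}\},\{\overline{i},j\}\}$ with $1\le j<i\le n+1$. Two $B$-diagonals cross if a diagonal of one and a diagonal of the other meet in the interior of the polygon. $\Gamma_n^B$ is the simplicial complex on the $B$-diagonals whose faces are the pairwise noncrossing sets; a facet is a maximal face. The Legendre polytope $P_n\subset\mathbb{R}^{n+1}$ is the convex hull of all $e_j-e_i$, $i\ne j$; the vertex $e_j-e_i$ is written $(i,j)$ (an arrow). The arrow representation maps $B$-diagonals to arrows: $\{i,\overline{i}\}\mapsto(i-1,i)$ for $2\le i\le n+1$, $\{1,\overline{1}\}\mapsto(n+1,1)$; $\{\{i,j\},\{\overline{i},\overline{j}\}\}\mapsto(j-1,i)$ for $1\le i<i+1<j\le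 n+1$; $\{\{i,\overline{j}\},\{\overline{i},j\}\}\mapsto(j-1,i)$ for $2\le j<i\le n+1$; $\{\{1,\overline{i}\},\{\overline{1},i\}\}\mapsto(n+1,i)$ for $2\le i\le n+1$. $P_n^+$ is the convex hull of the origin and all points $e_i-e_j$ with $1\le i<j\le n+1$. The permutation $\zeta=(1,2,\ldots,n+1)$ acts linearly on $\mathbb{R}^{n+1}$ by $e_i\mapsto e_{\zeta(i)}$. *)

(* Defs.v *)
From HB Require Import structures.
From mathcomp Require Import all_boot all_order all_fingroup all_algebra.
From mathcomp Require Import all_classical all_reals all_analysis.
Set Implicit Arguments.
Unset Strict Implicit.
Unset Printing Implicit Defensive.

Import Order.TTheory GRing.Theory Num.Theory.
Import numFieldNormedType.Exports.
Local Open Scope ring_scope.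

(* Labels 1, ..., n+1 are the elements 0, ..., n of 'I_n.+1: the ordinal i
   stands for the label i+1, so that [ord_pred i] is the label before it,
   with n+1 before 1. *)

(* The vertex (i, b) is barred iff b = true. *)
Definition vertex (n : nat) : finType := ('I_n.+1 * bool)%type.

Definition unbarred (n : nat) (i : 'I_n.+1) : vertex n := (i, false).
Definition barred (n : nat) (i : 'I_n.+1) : vertex n := (i, true).

(* A segment joining two vertices, and an antipodally symmetric set of such
   segments. *)
Notation chord n := {set vertex n}.
Notation chord_orbit n := {set {set vertex n}}.

Definition diameterB (n : nat) (i : 'I_n.+1) : chord_orbit n :=
  [set [set unbarred i; barred i]]%SET.

Definition straight_pair (n : nat) (i j : 'I_n.+1) : chord_orbit n :=
  [set [set unbarred i; unbarred j]; [set barred i; barred j]]%SET.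

Definition twisted_pair (n : nat) (i j : 'I_n.+1) : chord_orbit n :=
  [set [set unbarred i; barred j]; [set barred i; unbarred j]]%SET.

(* [B_arrow D (a, b)]: D is a B-diagonal and (a, b) is its arrow, with head b.
   The bound i < j + n excludes only the pair consisting of the sides
   {n+1, bar 1} and {bar (n+1), 1} of the polygon, which are not diagonals. *)
Inductive B_arrow (n : nat) : chord_orbit n -> 'I_n.+1 * 'I_n.+1 -> Prop :=
| B_arrow_diameter (i : 'I_n.+1) :
    B_arrow (diameterB i) (ord_pred i, i)
| B_arrow_straight (i j : 'I_n.+1) :
    (i.+1 < j)%N -> B_arrow (straight_pair i j) (ord_pred j, i)
| B_arrow_twisted (i j : 'I_n.+1) :
    (j < i < j + n)%N -> B_arrow (twisted_pair i j) (ord_pred j, i).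

Definition B_diagonal (n : nat) (D : chord_orbit n) : Prop :=
  exists a, B_arrow D a.

Definition convex_hull (R : realType) (m : nat) (A : set 'rV[R]_m) :
    set 'rV[R]_m :=
  smallest (@convex_set R 'rV[R]_m) A.

(* Number of clockwise steps from the vertex 1. *)
Definition position (n : nat) (v : vertex n) : nat := (v.1 + v.2 * n.+1)%N.

Definition vertex_point (R : realType) (n : nat) (v : vertex n) : 'rV[R]_2 :=
  let theta := 2 * pi * (position v)%:R / (2 * n + 2)%:R in
  \row_(c < 2) if c == 0 then cos theta else - sin theta.
Arguments vertex_point R {n} v.

Definition polygon (R : realType) (n : nat) : set 'rV[R]_2 :=
  convex_hull (range (@vertex_point R n)).
Arguments polygon R n : clear implicits.

Definition segment (R : realType) (n : nat) (d : chord n) : set 'rV[R]_2 :=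
  convex_hull (vertex_point R @` [set` d])%classic.
Arguments segment R {n} d.

Definition crossing (R : realType) (n : nat) (D E : chord_orbit n) : Prop :=
  exists d e, [/\ d \in D, e \in E &
    (segment R d `&` segment R e `&` interior (polygon R n) !=set0)%classic].

Definition face (R : realType) (n : nat) (F : {set chord_orbit n}) : Prop :=
  {in F, forall D, B_diagonal D} /\
  {in F &, forall D E, D != E -> ~ crossing R D E}.

Definition facet (R : realType) (n : nat) (F : {set chord_orbit n}) : Prop :=
  face R F /\ forall G, face R G -> F \subset G -> G = F.

Definition unit_vector (R : realType) (n : nat) (i : 'I_n.+1) : 'rV[R]_n.+1 :=
  delta_mx 0 i.
Arguments unit_vector R {n} i.

Definition arrow_point (R : realType) (n : nat) (a : 'I_n.+1 * 'I_n.+1) :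
    'rV[R]_n.+1 :=
  unit_vector R a.2 - unit_vector R a.1.
Arguments arrow_point R {n} a.

Definition arrows_of (n : nat) (F : {set chord_orbit n}) :
    set ('I_n.+1 * 'I_n.+1) :=
  [set a | exists2 D, D \in F & B_arrow D a]%classic.

Definition arrow_simplex (R : realType) (n : nat) (F : {set chord_orbit n}) :
    set 'rV[R]_n.+1 :=
  convex_hull (arrow_point R @` arrows_of F)%classic.
Arguments arrow_simplex R {n} F.

Definition P_plus (R : realType) (n : nat) : set 'rV[R]_n.+1 :=
  convex_hull ([set 0] `|`
    [set x | exists i j : 'I_n.+1,
       (i < j)%N /\ x = unit_vector R i - unit_vector R j])%classic.
Arguments P_plus R n : clear implicits.

Definition zeta (n : nat) : 'S_n.+1 := perm (@ordS_inj n.+1).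

(* On row vectors, the linear map e_i |-> e_(s i) is right multiplication by
   [perm_mx s]. *)
Definition perm_act (R : realType) (n : nat) (s : 'S_n.+1) (x : 'rV[R]_n.+1) :
    'rV[R]_n.+1 :=
  x *m perm_mx s.

(* The image of P_plus under the power of zeta given by the ordinal k, i.e. by
   one less than the label k stands for. *)
Definition rotated_P_plus (R : realType) (n : nat) (k : 'I_n.+1) :
    set 'rV[R]_n.+1 :=
  (perm_act (zeta n ^+ k)%g @` P_plus R n)%classic.
Arguments rotated_P_plus R {n} k.

(* Main.v *)
(* Label the vertices of the (2n+2)-gon by natural numbers modulo 2N, N = n+1, so
   that a B-diagonal becomes the centrally symmetric orbit of a chord {r, s} with
   r < N and r + 2 <= s <= r + N, whose arrow is (s-1, r) modulo N. Two chords
   with alternating endpoints meet in the interior of the polygon, while a chord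
   on one side of a diameter meets it at most in a vertex. Hence {r, s} crosses
   the diameter {k, k+N} iff r < k < s or r < k+N < s; when this fails, s-1-k and
   r-k reduce modulo N to numbers in increasing order r-k < s-1-k, which puts the
   arrow in the k-th rotation of P_n^+. Conversely, the linear form
   sum_i i x_i is nonpositive on P_n^+, and among the arrows (k'-1, k') the
   preimage under the rotation satisfies this only for k' = k. *)
Require Import Defs.
From HB Require Import structures.
From mathcomp Require Import all_boot all_order all_fingroup all_algebra.
From mathcomp Require Import all_classical all_reals all_analysis.
From mathcomp Require Import ring lra zify.

Set Implicit Arguments.
Unset Strict Implicit.
Unset Printing Implicit Defensive.

Import Order.TTheory GRing.Theory Num.Theory.
Import numFieldNormedType.Exports.
Local Open Scope ring_scope.

(** * Convex hulls *)

Section Convexity.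
Context {R : realType} {m : nat}.
Implicit Types (A C : set 'rV[R]_m) (x y : 'rV[R]_m).

Lemma convex_setE A :
  @convex_set R 'rV[R]_m A <->
  forall x y (t : R), 0 <= t <= 1 -> A x -> A y -> A (t *: x + (1 - t) *: y).
Proof.
split=> [cA x y t t01 Ax Ay|cA x y t /set_mem Ax /set_mem Ay].
  have := cA x y (Itv01 (andP t01).1 (andP t01).2) (mem_set Ax) (mem_set Ay).
  by move/set_mem.
by apply/mem_set/cA => //; rewrite ge0 le1.
Qed.

Lemma sub_convex_hull A : (A `<=` convex_hull A)%classic.
Proof. exact: sub_gen_smallest. Qed.

Lemma convex_hull_sub A C :
  @convex_set R 'rV[R]_m C -> (A `<=` C -> convex_hull A `<=` C)%classic.
Proof. by move=> cC AC; apply: smallest_sub. Qed.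

Lemma convex_hull_convex A : @convex_set R 'rV[R]_m (convex_hull A).
Proof.
apply/convex_setE => x y t t01 Ax Ay C [cC AC].
by move/convex_setE: (cC); apply => //; [exact: Ax|exact: Ay].
Qed.

Lemma convex_hull_conv A x y (t : R) : 0 <= t <= 1 ->
  convex_hull A x -> convex_hull A y -> convex_hull A (t *: x + (1 - t) *: y).
Proof. by move: x y t; apply/convex_setE/convex_hull_convex. Qed.

Lemma convex_halfspace (f : 'rV[R]_m -> R) (c : R) :
  (forall x y (t : R), f (t *: x + (1 - t) *: y) = t * f x + (1 - t) * f y) ->
  @convex_set R 'rV[R]_m [set x | f x <= c]%classic.
Proof.
move=> affine_f; apply/convex_setE => x y t /andP[t0 t1] /= fx fy.
rewrite affine_f (_ : c = t * c + (1 - t) * c); last by ring.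
by apply: lerD; apply: ler_wpM2l; rewrite ?subr_ge0.
Qed.

Lemma convex_hull2 x y z : convex_hull [set x; y]%classic z ->
  exists2 t : R, 0 <= t <= 1 & z = t *: x + (1 - t) *: y.
Proof.
pose C := [set z | exists2 t : R, 0 <= t <= 1 & z = t *: x + (1 - t) *: y]%classic.
move: z; apply: (@convex_hull_sub _ C).
  apply/convex_setE => u v t /andP[t0 t1] [a /andP[a0 a1] ->] [b /andP[b0 b1] ->].
  exists (t * a + (1 - t) * b); first by apply/andP; split; nra.
  apply/rowP => i; rewrite !mxE; ring.
move=> u [->|->] /=; [exists 1|exists 0]; rewrite ?ler01 ?lexx //.
  by rewrite subrr scale0r scale1r addr0.
by rewrite subr0 scale0r scale1r add0r.
Qed.

(** Weights are left unnormalised so that triangle areas can serve as weights and combinations of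
    four points arise by nesting. *)
Lemma convex_hull_comb2 A x y (a b : R) : 0 < a -> 0 < b ->
  convex_hull A x -> convex_hull A y ->
  convex_hull A ((a + b)^-1 *: (a *: x + b *: y)).
Proof.
move=> a0 b0 Ax Ay; have ab0 : a + b != 0 by apply/lt0r_neq0/addr_gt0.
have -> : (a + b)^-1 *: (a *: x + b *: y) =
    (a / (a + b)) *: x + (1 - a / (a + b)) *: y.
  by apply/rowP => i; rewrite !mxE; field.
apply: convex_hull_conv => //.
have s0 : 0 < a + b by rewrite addr_gt0.
by rewrite ler_pdivrMr // mul1r lerDl !ltW //= divr_gt0.
Qed.

End Convexity.

(** * Diagonals of a convex quadrangle *)

Section Quadrangle.
Context {R : realType}.
Implicit Types (u v w x y : 'rV[R]_2).

(* Twice the signed area of the triangle u v w, positive when it is traversed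
   clockwise. *)
Definition area u v w : R :=
  (v 0 1 - u 0 1) * (w 0 0 - u 0 0) - (v 0 0 - u 0 0) * (w 0 1 - u 0 1).

Lemma rV2P u v : u 0 0 = v 0 0 -> u 0 1 = v 0 1 -> u = v.
Proof.
move=> e0 e1; apply/rowP; case=> -[|[|//]] i2.
  by rewrite (_ : Ordinal i2 = 0) //; apply: val_inj.
by rewrite (_ : Ordinal i2 = 1) //; apply: val_inj.
Qed.

Lemma continuous_area2 u w : continuous (fun y => area u y w).
Proof.
move=> y; have c i : {for y, continuous (fun y : 'rV[R]_2 => y 0 i)}.
  exact: coord_continuous.
have cM i (a b : R) :
    {for y, continuous (fun y : 'rV[R]_2 => (y 0 i - a) * b)}.
  apply: continuousM; last exact: cst_continuous.
  by apply: continuousB; [exact: c|exact: cst_continuous].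
exact: (continuousB (cM 1 (u 0 1) (w 0 0 - u 0 0)) (cM 0 (u 0 0) (w 0 1 - u 0 1))).
Qed.

Lemma area_rotate u v w : area u v w = area v w u.
Proof. rewrite /area; ring. Qed.

Lemma continuous_area1 v w : continuous (fun y => area y v w).
Proof.
under eq_fun do rewrite area_rotate area_rotate.
exact: continuous_area2.
Qed.

Lemma continuous_area3 u v : continuous (fun y => area u v y).
Proof.
under eq_fun do rewrite area_rotate.
exact: continuous_area2.
Qed.

(** The areas [d1], ..., [d4] of the triangles omitting one vertex are weights of the intersection
    point: [d1], [d3] on one diagonal, [d2], [d4] on the other. Averaging both expressions puts
    positive weight on all four vertices, which survives small moves. *)
Lemma quadrangle_diagonals_meet (A : set 'rV[R]_2) v1 v2 v3 v4 :
  convex_hull A v1 -> convex_hull A v2 -> convex_hull A v3 -> convex_hull A v4 ->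
  0 < area v1 v2 v3 -> 0 < area v1 v2 v4 ->
  0 < area v1 v3 v4 -> 0 < area v2 v3 v4 ->
  exists x, [/\ convex_hull [set v1; v3]%classic x,
    convex_hull [set v2; v4]%classic x & interior (convex_hull A) x].
Proof.
move=> A1 A2 A3 A4; set d4 := area v1 v2 v3; set d3 := area v1 v2 v4.
set d2 := area v1 v3 v4; set d1 := area v2 v3 v4 => p4 p3 p2 p1.
have sE : d1 + d3 = d2 + d4 by rewrite /d1 /d2 /d3 /d4 /area; ring.
have xE : d1 *: v1 + d3 *: v3 = d2 *: v2 + d4 *: v4.
  by apply: rV2P; rewrite !mxE /d1 /d2 /d3 /d4 /area; ring.
have aE z : area z v2 v3 + area v1 z v3 + area v1 v2 z = d4.
  by rewrite /d4 /area; ring.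
have bary z : area z v2 v3 *: v1 + area v1 z v3 *: v2 + area v1 v2 z *: v3 =
    d4 *: z.
  by apply: rV2P; rewrite !mxE /d4 /area; ring.
clearbody d1 d2 d3 d4.
have s_gt0 : 0 < d1 + d3 by exact: addr_gt0.
have s0 : d1 + d3 != 0 by exact: lt0r_neq0.
pose x := (d1 + d3)^-1 *: (d1 *: v1 + d3 *: v3).
exists x; split.
- by apply: convex_hull_comb2 => //; apply: sub_convex_hull; [left|right].
- rewrite /x sE xE.
  by apply: convex_hull_comb2 => //; apply: sub_convex_hull; [left|right].
(* Half the weights of [x], plus the change from [x] to [y] of the barycentric coordinates in the
   triangle [v1], [v2], [v3]. *)
pose l1 y := d1 / (d1 + d3) / 2 + (area y v2 v3 - area x v2 v3) / d4.
pose l2 y := d2 / (d1 + d3) / 2 + (area v1 y v3 - area v1 x v3) / d4.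
pose l3 y := d3 / (d1 + d3) / 2 + (area v1 v2 y - area v1 v2 x) / d4.
pose l4 : R := d4 / (d1 + d3) / 2.
have near_pos (d : R) (f : 'rV[R]_2 -> R) : 0 < d -> continuous f ->
    \forall y \near x, 0 < d / (d1 + d3) / 2 + (f y - f x) / d4.
  move=> d0 cf; pose g y := (f y - f x) / d4.
  have cg : {for x, continuous g}.
    apply: continuousM; last exact: cst_continuous.
    by apply: continuousB; [exact: cf|exact: cst_continuous].
  have := continuousD (@cst_continuous _ _ (d / (d1 + d3) / 2) x) cg.
  move/cvgr_gt; apply.
  rewrite -[ltRHS]/(d / (d1 + d3) / 2 + (f x - f x) / d4).
  by rewrite subrr mul0r addr0 !divr_gt0.
rewrite /interior /=.
have n1 := near_pos d1 _ p1 (@continuous_area1 v2 v3).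
have n2 := near_pos d2 _ p2 (@continuous_area2 v1 v3).
have n3 := near_pos d3 _ p3 (@continuous_area3 v1 v2).
near=> y.
have l1p : 0 < l1 y by near: y.
have l2p : 0 < l2 y by near: y.
have l3p : 0 < l3 y by near: y.
have l4p : 0 < l4 by rewrite !divr_gt0.
have sl : (l1 y + l2 y) + (l3 y + l4) = 1.
  have -> : l1 y + l2 y + (l3 y + l4) =
    (d1 / (d1 + d3) + d2 / (d1 + d3) + d3 / (d1 + d3) + d4 / (d1 + d3)) / 2 +
    ((area y v2 v3 + area v1 y v3 + area v1 v2 y) -
     (area x v2 v3 + area v1 x v3 + area v1 v2 x)) / d4.
    by rewrite /l1 /l2 /l3 /l4; ring.
  have d4E : d4 = d1 + d3 - d2 by rewrite sE addrC addKr.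
  by rewrite !aE subrr mul0r d4E; field.
have yE : y = l1 y *: v1 + l2 y *: v2 + (l3 y *: v3 + l4 *: v4).
  have d40 : d4 != 0 by rewrite gt_eqF.
  have xE2 : x = (d1 + d3)^-1 *: (d2 *: v2 + d4 *: v4) by rewrite -xE.
  have -> : l1 y *: v1 + l2 y *: v2 + (l3 y *: v3 + l4 *: v4) =
    2^-1 *: ((d1 + d3)^-1 *: (d1 *: v1 + d3 *: v3) +
             (d1 + d3)^-1 *: (d2 *: v2 + d4 *: v4)) +
    d4^-1 *: ((area y v2 v3 *: v1 + area v1 y v3 *: v2 + area v1 v2 y *: v3) -
     (area x v2 v3 *: v1 + area v1 x v3 *: v2 + area v1 v2 x *: v3)).
    by apply/rowP => i; rewrite !mxE /l1 /l2 /l3 /l4; ring.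
  rewrite !bary -xE2 -/x -scalerBr scalerA mulVf // scale1r -mulr2n.
  by rewrite -[x *+ 2]scaler_nat scalerA mulVf ?pnatr_eq0 // scale1r addrC subrK.
have := convex_hull_comb2 (addr_gt0 l1p l2p) (addr_gt0 l3p l4p)
  (convex_hull_comb2 l1p l2p A1 A2) (convex_hull_comb2 l3p l4p A3 A4).
have n12 := lt0r_neq0 (addr_gt0 l1p l2p).
have n34 := lt0r_neq0 (addr_gt0 l3p l4p).
by rewrite sl invr1 scale1r !scalerA !mulfV // !scale1r -yE.
Unshelve. all: by end_near.
Qed.

End Quadrangle.

(** * Vertices of the polygon *)

Section CirclePoints.
Context {R : realType} {n : nat}.
Local Notation N := n.+1.

Definition angle (k : nat) : R := 2 * pi * k%:R / (2 * n + 2)%:R.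

(** Inscribed angles are half the central ones, so areas of inscribed triangles factor into sines of
    differences of half-angles. *)
Definition half_angle (k : nat) : R := pi * k%:R / (2 * n + 2)%:R.

Definition circle_point (k : nat) : 'rV[R]_2 :=
  \row_(c < 2) if c == 0 then cos (angle k) else - sin (angle k).

Lemma angleE k : angle k = half_angle k *+ 2.
Proof.
rewrite /angle /half_angle mulr2n; field.
by rewrite -natrM -natrD pnatr_eq0 addnC.
Qed.

Lemma half_angleB a b : half_angle (a + b) - half_angle a = half_angle b.
Proof. by rewrite /half_angle natrD -mulrBl -mulrBr addrC addKr. Qed.

Lemma half_angle_half k : half_angle (k + N) = half_angle k + pi / 2.
Proof.
rewrite /half_angle natrD -(natr1 n) natrD natrM; field.
by rewrite -natrM -natrD pnatr_eq0 addnC.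
Qed.

Lemma half_angle_bound k : (0 < k < 2 * N)%N -> 0 < half_angle k < pi.
Proof.
case/andP=> k0 kN; have N0 : 0 < (2 * n + 2)%:R :> R by rewrite ltr0n addnC.
apply/andP; split.
  by apply: divr_gt0 => //; apply: mulr_gt0; rewrite ?pi_gt0 ?ltr0n.
by rewrite /half_angle ltr_pdivrMr // ltr_pM2l ?pi_gt0 // ltr_nat; lia.
Qed.

Lemma circle_point0 k :
  circle_point k 0 0 = cos (half_angle k) ^+ 2 - sin (half_angle k) ^+ 2.
Proof.
by rewrite mxE /= angleE cos_mulr2n -(cos2Dsin2 (half_angle k)); ring.
Qed.

Lemma circle_point1 k :
  circle_point k 0 1 = - (cos (half_angle k) * sin (half_angle k) *+ 2).
Proof. by rewrite mxE /= angleE sin_mulr2n. Qed.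

Lemma area_circle_point a b c :
  area (circle_point a) (circle_point b) (circle_point c) =
  4 * sin (half_angle b - half_angle a) * sin (half_angle c - half_angle b) *
    sin (half_angle c - half_angle a).
Proof.
set u := circle_point a; set v := circle_point b; set w := circle_point c.
(* Each factor [1] becomes cos^2 + sin^2 of the half-angle of the vertex absent from its term, which
   makes the identity homogeneous. *)
have -> : area u v w =
    (v 0 1 * w 0 0 - v 0 0 * w 0 1) * 1 - (u 0 1 * w 0 0 - u 0 0 * w 0 1) * 1 +
    (u 0 1 * v 0 0 - u 0 0 * v 0 1) * 1 by rewrite /area; ring.
rewrite -{1}(cos2Dsin2 (half_angle a)) -{1}(cos2Dsin2 (half_angle b)).
rewrite -{1}(cos2Dsin2 (half_angle c)) !sinB.
rewrite /u /v /w !circle_point0 !circle_point1; ring.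
Qed.

(** Within one full turn all differences of half-angles lie strictly between 0 and pi. *)
Lemma area_circle_point_gt0 a b c : (a < b)%N -> (b < c)%N -> (c < a + 2 * N)%N ->
  0 < area (circle_point a) (circle_point b) (circle_point c).
Proof.
move=> ab bc ca; have sB i j : (i < j)%N -> (j < i + 2 * N)%N ->
    0 < sin (half_angle j - half_angle i).
  move=> ij ji; rewrite -(subnKC (ltnW ij)) half_angleB.
  by apply/sin_gt0_pi/half_angle_bound; lia.
by rewrite area_circle_point !mulr_gt0 ?ltr0n // sB //; lia.
Qed.

Lemma circle_point_antipode k : circle_point (k + N) = - circle_point k.
Proof.
apply: rV2P; rewrite [RHS]mxE ?circle_point0 ?circle_point1 half_angle_half
  cosDpihalf sinDpihalf; ring.
Qed.

Lemma circle_point_period k q : circle_point (k + q * (2 * N)) = circle_point k.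
Proof.
elim: q => [|q IH]; first by rewrite mul0n addn0.
rewrite -[RHS]IH -[RHS]opprK -!circle_point_antipode; congr circle_point; lia.
Qed.

(** Inverse of [position], extended with period [2 * N], so that adding [N] is the antipodal map. *)
Definition nat_vertex (k : nat) : vertex n :=
  (inord (k %% N), odd (k %/ N)).

Lemma vertex_point_nat k : vertex_point R (nat_vertex k) = circle_point k.
Proof.
rewrite -[LHS]/(circle_point _) /position /= inordK ?ltn_pmod //.
rewrite -(circle_point_period _ (k %/ N)./2); congr circle_point.
rewrite [RHS](divn_eq k N) -[in RHS](odd_double_half (k %/ N)) -muln2.
by rewrite mulnDl -mulnA [RHS]addnC addnA.
Qed.

Lemma nat_vertex_period k : nat_vertex (k + 2 * N) = nat_vertex k.
Proof. by rewrite /nat_vertex addnC modnMDl divnMDl // oddD. Qed.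

Lemma nat_vertex_ord (i : 'I_N) : nat_vertex i = unbarred i.
Proof. by rewrite /nat_vertex modn_small // divn_small // inord_val. Qed.

Lemma nat_vertex_ordN (i : 'I_N) : nat_vertex (i + N) = barred i.
Proof.
by rewrite /nat_vertex modnDr modn_small // divnDr // divn_small // divnn inord_val.
Qed.

Lemma segment_nat_vertex i j : segment R [set nat_vertex i; nat_vertex j]%SET =
  convex_hull [set circle_point i; circle_point j]%classic.
Proof.
rewrite /segment; congr convex_hull; apply/seteqP; split=> [x [v /=]|x [->|->]].
- by rewrite !inE => /orP[] /eqP -> <-; [left|right]; rewrite vertex_point_nat.
- by exists (nat_vertex i); rewrite ?vertex_point_nat //= !inE eqxx.
- by exists (nat_vertex j); rewrite ?vertex_point_nat //= !inE eqxx orbT.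
Qed.

Lemma crossing_sym (D E : chord_orbit n) : crossing R D E -> crossing R E D.
Proof.
move=> [d [e [? ? ?]]]; exists e, d; split=> //.
by rewrite [X in (X `&` _)%classic]setIC.
Qed.

(** Four points in clockwise order within one turn form a convex quadrangle with the two chords as
    diagonals. *)
Lemma alternating_crossing (D E : chord_orbit n) (a b c d : nat) :
  (a < b)%N -> (b < c)%N -> (c < d)%N -> (d < a + 2 * N)%N ->
  [set nat_vertex a; nat_vertex c]%SET \in D ->
  [set nat_vertex b; nat_vertex d]%SET \in E -> crossing R D E.
Proof.
move=> ab bc cd da Dac Ebd; do 2?eexists; split; [exact: Dac|exact: Ebd|].
have hull k : polygon R n (circle_point k).
  by apply: sub_convex_hull; exists (nat_vertex k) => //; exact: vertex_point_nat.
have [x [x1 x2 x3]] : exists x,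
    [/\ convex_hull [set circle_point a; circle_point c]%classic x,
    convex_hull [set circle_point b; circle_point d]%classic x &
    interior (polygon R n) x].
  by apply: quadrangle_diagonals_meet; (exact: hull || apply: area_circle_point_gt0; lia).
by exists x; split=> //; split; rewrite segment_nat_vertex.
Qed.

End CirclePoints.

(** * Chords on one side of a diameter *)

Section DiameterCrossing.
Context {R : realType} {n : nat}.
Local Notation N := n.+1.
Local Notation circle_point := (@circle_point R n).
Local Notation angle := (@angle R n).

(** The linear form given by the inner product with [u] is at most 1 on the polygon and equals 1 at
    [u], so points slightly beyond [u] lie outside. *)
Lemma circle_point_not_interior k : ~ interior (polygon R n) (circle_point k).
Proof.
set u := circle_point k; rewrite /interior /= => /nbhs_ballP[e /= e0 ball_u].
pose f (x : 'rV[R]_2) := x 0 0 * u 0 0 + x 0 1 * u 0 1.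
have f_circle j : f (circle_point j) = cos (angle j - angle k).
  by rewrite /f !mxE /= cosB mulrNN.
have f_le1 x : polygon R n x -> f x <= 1.
  apply: (@convex_hull_sub _ _ _ [set x | f x <= 1]%classic).
    by apply: convex_halfspace => ? ? ?; rewrite /f !mxE; ring.
  by move=> _ [v _ <-] /=; rewrite -[vertex_point _ v]/(circle_point _) f_circle cos_le1.
have : f ((1 + e / 2) *: u) <= 1.
  apply: f_le1; apply: ball_u; split=> // i j; rewrite /ball /= [X in _ - X]mxE.
  have u_le1 : `|u i j| <= 1.
    by rewrite mxE /=; case: eqP => _; rewrite ?normrN ?cos_max ?sin_max.
  have -> : u i j - (1 + e / 2) * u i j = - (e / 2 * u i j) by ring.
  by rewrite normrN normrM ger0_norm; [nra|lra].
have -> : f ((1 + e / 2) *: u) = (1 + e / 2) * f u by rewrite /f !mxE; ring.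
by rewrite f_circle subrr cos0; lra.
Qed.

(* Vanishes exactly on the line through the points p and p + N, and is positive
   on the points strictly between them. *)
Definition side (p : nat) (x : 'rV[R]_2) : R :=
  - (x 0 0 * sin (angle p) + x 0 1 * cos (angle p)).

Lemma side_circle_point p k : side p (circle_point k) = sin (angle k - angle p).
Proof. by rewrite /side !mxE /= sinB; rewrite /angle; ring. Qed.

Lemma side_antipode p k :
  side p (circle_point (k + N)) = - side p (circle_point k).
Proof. by rewrite circle_point_antipode /side !mxE; ring. Qed.

Lemma side_self p : side p (circle_point p) = 0.
Proof. by rewrite side_circle_point subrr sin0. Qed.

Lemma side_gt0 p k : (p < k < p + N)%N -> 0 < side p (circle_point k).
Proof.
case/andP=> pk kp; rewrite side_circle_point /angle -mulrBl -mulrBr -natrB ?(ltnW pk) //.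
have N0 : 0 < (2 * n + 2)%:R :> R by rewrite ltr0n addnC.
apply: sin_gt0_pi; apply/andP; split.
  by apply: divr_gt0 => //; rewrite !mulr_gt0 ?pi_gt0 ?ltr0n ?subn_gt0.
rewrite ltr_pdivrMr // -mulrA mulrCA ltr_pM2l ?pi_gt0 // -natrM ltr_nat; lia.
Qed.

Lemma side_ge0 p k : (p <= k <= p + N)%N -> 0 <= side p (circle_point k).
Proof.
case/andP; rewrite leq_eqVlt => /orP[/eqP <-|pk]; first by rewrite side_self.
rewrite leq_eqVlt => /orP[/eqP ->|kp]; last by rewrite ltW // side_gt0 ?pk.
by rewrite side_antipode side_self oppr0.
Qed.

(** [side p] vanishes at a common point, and the endpoint values have no opposite signs and are not
    both 0. The point is therefore an endpoint, hence a vertex of the polygon. *)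
Lemma one_sided_segment_not_crossing (p r s : nat) x :
  0 <= side p (circle_point r) * side p (circle_point s) ->
  (side p (circle_point r) != 0) || (side p (circle_point s) != 0) ->
  convex_hull [set circle_point p; circle_point (p + N)]%classic x ->
  convex_hull [set circle_point r; circle_point s]%classic x ->
  ~ interior (polygon R n) x.
Proof.
set a := side p _; set b := side p _ => ab_ge0 ab_neq0.
have sideD y z (t : R) : side p (t *: y + (1 - t) *: z) =
    t * side p y + (1 - t) * side p z by rewrite /side !mxE; ring.
case/convex_hull2 => t0 _ ->; set y := t0 *: _ + _.
have y0 : side p y = 0.
  by rewrite /y sideD side_antipode side_self oppr0 !mulr0 addr0.
case/convex_hull2 => t /andP[t_ge0 t_le1] yE; rewrite yE.
move: y0; rewrite yE sideD -/a -/b => ab0.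
have [->|t_neq0] := eqVneq t 0.
  by rewrite scale0r add0r subr0 scale1r; exact: circle_point_not_interior.
have [->|t_neq1] := eqVneq t 1.
  by rewrite subrr scale0r addr0 scale1r; exact: circle_point_not_interior.
have t_gt0 : 0 < t by rewrite lt_neqAle eq_sym t_neq0.
have t_lt1 : 0 < 1 - t by rewrite subr_gt0 lt_neqAle t_neq1.
(* Multiplying the equation by [a] and by [b] turns it into vanishing sums of nonnegative terms. *)
have a0 : t * a ^+ 2 + (1 - t) * (a * b) = 0 by rewrite -[RHS](mulr0 a) -ab0; ring.
have b0 : t * (a * b) + (1 - t) * b ^+ 2 = 0 by rewrite -[RHS](mulr0 b) -ab0; ring.
case/orP: ab_neq0 => [a_neq0|b_neq0].
- have /(mulr_gt0 t_gt0) : 0 < a ^+ 2 by rewrite exprn_even_gt0.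
  by have := mulr_ge0 (ltW t_lt1) ab_ge0; lra.
- have /(mulr_gt0 t_lt1) : 0 < b ^+ 2 by rewrite exprn_even_gt0.
  by have := mulr_ge0 t_ge0 ab_ge0; lra.
Qed.

End DiameterCrossing.

(** * B-diagonals *)

Section PairOrbits.
Context {n : nat}.
Local Notation N := n.+1.
Local Notation nat_vertex := (@nat_vertex n).

(* Every B-diagonal is [pair_orbit r s] for some [r < N] and [r + 2 <= s <= r + N],
   the diameters being the case [s = r + N]. *)
Definition pair_orbit (r s : nat) : chord_orbit n :=
  [set [set nat_vertex r; nat_vertex s];
       [set nat_vertex (r + N); nat_vertex (s + N)]]%SET.

Lemma nat_vertex_ordNN (i : 'I_N) : nat_vertex (i + N + N) = unbarred i.
Proof. by rewrite -addnA addnn -mul2n nat_vertex_period nat_vertex_ord. Qed.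

Lemma diameter_orbit (k : 'I_N) : diameterB k = pair_orbit k (k + N).
Proof.
rewrite /pair_orbit nat_vertex_ordNN nat_vertex_ordN nat_vertex_ord.
by rewrite [[set barred k; _]%SET]finset.setUC finset.setUid.
Qed.

Lemma modn_shift (s : nat) : (N <= s < 2 * N)%N -> (s %% N = s - N)%N.
Proof.
by case/andP=> Ns sN; rewrite -{1}(subnK Ns) modnDr modn_small //; lia.
Qed.

(** Lifting a barred endpoint [j] to [j + N] merges the three kinds of arrows into one formula. For
    a diameter, [r.+1 < s] comes from [0 < n]. *)
Lemma B_arrow_orbit (D : chord_orbit n) a : (0 < n)%N -> B_arrow D a ->
  exists r s, [/\ (r < N)%N, (r.+1 < s <= r + N)%N, D = pair_orbit r s &
    a = (inord (s.-1 %% N)%N, inord r)].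
Proof.
move=> n_gt0; case=> [i|i j ij|i j /andP[ji ij]].
- exists i, (i + N)%N; split=> //; [lia|exact: diameter_orbit|].
  by rewrite inord_val; congr pair; apply: val_inj; rewrite /= inordK ?ltn_pmod.
- exists i, j; split=> //.
  + by have := ltn_ord j; lia.
  + by rewrite /pair_orbit !nat_vertex_ordN !nat_vertex_ord.
  + rewrite inord_val; congr pair; apply: val_inj; rewrite /= inordK ?ltn_pmod //.
    by rewrite (_ : (j + N).-1 = j.-1 + N)%N ?modnDr //; lia.
- exists i, (j + N)%N; split=> //.
  + by have := ltn_ord i; lia.
  + by rewrite /pair_orbit nat_vertex_ordNN !nat_vertex_ordN !nat_vertex_ord.
  + by rewrite inord_val; congr pair; apply: val_inj; rewrite /= inordK ?ltn_pmod.
Qed.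

Lemma orbit_endpoint (p q r s : nat) : pair_orbit p q = pair_orbit r s ->
  (p %% N = r %% N)%N \/ (p %% N = s %% N)%N.
Proof.
move/setP/(_ [set nat_vertex p; nat_vertex q]%SET); rewrite !inE eqxx /= => /esym.
have modE i j : nat_vertex i = nat_vertex j -> (i %% N = j %% N)%N.
  by case=> /(congr1 val) /=; rewrite !inordK ?ltn_pmod.
case/orP=> /eqP/setP/(_ (nat_vertex p)); rewrite !inE eqxx /= => /esym/orP[] /eqP /modE;
  rewrite ?modnDr; by [left|right].
Qed.

(** Modulo [N] an orbit has only the endpoints [r] and [s]. This covers the case of equal orbits,
    about which noncrossing says nothing. *)
Lemma orbit_endpoint_not_between (p q r s : nat) :
  (p < N)%N -> (r < N)%N -> (r < s <= r + N)%N ->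
  pair_orbit p q = pair_orbit r s -> ~~ ((r < p < s) || (r < p + N < s))%N.
Proof.
move=> pN rN /andP[rs sr] /orbit_endpoint; rewrite (modn_small pN) (modn_small rN).
have [sN|Ns] := ltnP s N; first by rewrite (modn_small sN); lia.
by rewrite modn_shift; lia.
Qed.

Context {R : realType}.

Lemma diameter_crossing (k : 'I_N) (r s : nat) :
  (r < N)%N -> (r < s <= r + N)%N -> (r < k < s)%N || (r < k + N < s)%N ->
  crossing R (diameterB k) (pair_orbit r s).
Proof.
move=> rN rs cr; have kN := ltn_ord k.
have kE : [set nat_vertex k; nat_vertex (k + N)]%SET \in diameterB k.
  by rewrite nat_vertex_ordN nat_vertex_ord inE.
(* The same diameter half a turn later, for the case where [k + N] is the endpoint between [r] and
   [s]. *)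
have kE' : [set nat_vertex (k + N); nat_vertex (k + N + N)]%SET \in diameterB k.
  by rewrite nat_vertex_ordNN nat_vertex_ordN finset.setUC inE.
have rsE : [set nat_vertex r; nat_vertex s]%SET \in pair_orbit r s.
  by rewrite !inE eqxx.
apply: crossing_sym.
case/orP: cr => /andP[rk ks].
- by apply: (alternating_crossing rk ks _ _ rsE kE); lia.
- by apply: (alternating_crossing rk ks _ _ rsE kE'); lia.
Qed.

Lemma diameter_not_crossing (k : 'I_N) (r s : nat) :
  (r < N)%N -> (r < s <= r + N)%N -> diameterB k != pair_orbit r s ->
  ~~ ((r < k < s) || (r < k + N < s))%N ->
  ~ crossing R (diameterB k) (pair_orbit r s).
Proof.
move=> rN /andP[rs sr] neq ncr [d [e [/set1P -> eE]]].
have kN := ltn_ord k.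
rewrite -nat_vertex_ord -nat_vertex_ordN segment_nat_vertex => -[x [[xk xe]]].
pose a := @side R n k (@circle_point R n r); pose b := @side R n k (@circle_point R n s).
have [ab_ge0 ab_neq0] : 0 <= a * b /\ (a != 0) || (b != 0).
  (* Both endpoints lie in [k, k + N] or both in [k - N, k]; the latter range is shifted by [N],
     which flips the sign of [side]. *)
  have [kr|rk] := leqP k r.
    have sk : (s <= k + N)%N by move: ncr; lia.
    have a_ge0 : 0 <= a by apply: side_ge0; lia.
    have b_ge0 : 0 <= b by apply: side_ge0; lia.
    split; first exact: mulr_ge0.
    have [lt_kr|le_rk] := ltnP k r.
      by apply/orP; left; apply/lt0r_neq0/side_gt0; lia.
    have rE : r = k by lia.
    have [lt_sk|le_ks] := ltnP s (k + N).
      by apply/orP; right; apply/lt0r_neq0/side_gt0; lia.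
    by case/eqP: neq; rewrite diameter_orbit rE; congr pair_orbit; lia.
  have sk : (s <= k)%N by move: ncr; lia.
  have a_gt0 : 0 < - a by rewrite -side_antipode; apply: side_gt0; lia.
  have b_ge0 : 0 <= - b by rewrite -side_antipode; apply: side_ge0; lia.
  by split; [rewrite -mulrNN mulr_ge0 // ltW|rewrite -oppr_eq0 gt_eqF].
move: eE; rewrite !inE => /orP[] /eqP eE; move: xe; rewrite eE segment_nat_vertex => xe.
- exact: (one_sided_segment_not_crossing _ _ xk xe).
- apply: (one_sided_segment_not_crossing _ _ xk xe); rewrite !side_antipode.
    by rewrite mulrNN.
  by rewrite (oppr_eq0 a) (oppr_eq0 b).
Qed.

End PairOrbits.

(** * The arrow polytope *)

Section ArrowPolytope.
Context {R : realType} {n : nat}.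
Local Notation N := n.+1.

Lemma zetaXE (k : nat) (i : 'I_N) : ((zeta n ^+ k)%g i = (i + k) %% N :> nat)%N.
Proof.
rewrite permX; elim: k => [|k IH]; first by rewrite addn0 modn_small.
by rewrite iterS permE /= IH -addn1 modnDml addn1 addnS.
Qed.

Lemma perm_act_arrow (s : 'S_N) (i j : 'I_N) :
  perm_act s (arrow_point R (i, j)) = arrow_point R (s i, s j).
Proof.
rewrite /perm_act /arrow_point /unit_vector mulmxBl.
by rewrite -!rowE; apply/rowP => l; rewrite !mxE !eqxx ![l == _]eq_sym.
Qed.

Lemma rotated_P_plus_convex (k : 'I_N) : @convex_set R 'rV[R]_N (rotated_P_plus R k).
Proof.
apply/convex_setE => _ _ t t01 [x Px <-] [y Py <-].
exists (t *: x + (1 - t) *: y); first exact: convex_hull_conv.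
by rewrite /perm_act mulmxDl !scalemxAl.
Qed.

Lemma arrow_in_rotated_P_plus (k i j : 'I_N) : (i < j)%N ->
  rotated_P_plus R k (arrow_point R ((zeta n ^+ k)%g j, (zeta n ^+ k)%g i)).
Proof.
move=> ij; exists (arrow_point R (j, i)); last exact: perm_act_arrow.
by apply: sub_convex_hull; right; exists i, j.
Qed.

(** The form [f] takes the value [i - j] at the preimage of the arrow. The inequality is weak
    because [i = j] gives the origin, which lies in [P_plus]. *)
Lemma arrow_of_rotated_P_plus (k i j : 'I_N) :
  rotated_P_plus R k (arrow_point R ((zeta n ^+ k)%g j, (zeta n ^+ k)%g i)) ->
  (i <= j)%N.
Proof.
case=> x Px xE.
have {}xE : x = arrow_point R (j, i).
  by move: xE; rewrite -perm_act_arrow /perm_act => /(can_inj (mulmxK (unitmx_perm _ _))).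
rewrite xE in Px; pose f (y : 'rV[R]_N) := \sum_(l < N) l%:R * y 0 l.
have f_arrow (a b : 'I_N) : f (arrow_point R (b, a)) = a%:R - b%:R.
  have fu c : f (unit_vector R c) = c%:R.
    rewrite /f (bigD1 c) //= big1 ?addr0; first by rewrite mxE !eqxx mulr1.
    by move=> l lc; rewrite mxE eqxx (negPf lc) mulr0.
  rewrite -[RHS]opprB -!fu /f /arrow_point opprB -sumrB; apply: eq_bigr => l _.
  by rewrite !mxE mulrBr.
have f_le0 y : P_plus R n y -> f y <= 0.
  apply: (@convex_hull_sub _ _ _ [set y | f y <= 0]%classic).
    apply: convex_halfspace => u v t; rewrite /f !mulr_sumr -big_split.
    by apply: eq_bigr => l _; rewrite !mxE /=; ring.
  move=> _ [->|[a [b [ab ->]]]] /=.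
    by rewrite /f big1 // => l _; rewrite mxE mulr0.
  by rewrite -[_ - _]/(arrow_point R (b, a)) f_arrow subr_le0 ler_nat ltnW.
by have := f_le0 _ Px; rewrite f_arrow subr_le0 ler_nat.
Qed.

End ArrowPolytope.

(** * Facets *)

Section Facets.
Context {R : realType} {n : nat}.
Local Notation N := n.+1.
Implicit Types (F : {set chord_orbit n}) (k : 'I_N).

Lemma face_not_between F k (r s : nat) : face R F -> diameterB k \in F ->
  (r < N)%N -> (r < s <= r + N)%N -> pair_orbit r s \in F ->
  ~~ ((r < k < s) || (r < k + N < s))%N.
Proof.
move=> [_ ncF] kF rN rs rsF; have [eq_k|neq_k] := eqVneq (diameterB k) (pair_orbit r s).
  by move: eq_k; rewrite diameter_orbit => /orbit_endpoint_not_between; apply.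
by apply/negP => bet; apply: (ncF _ _ kF rsF neq_k); exact: diameter_crossing.
Qed.

(** Distinct diameters cross: [k] or [k + N] lies strictly between [k'] and [k' + N]. *)
Lemma face_diameter_unique F k k' : face R F ->
  diameterB k \in F -> diameterB k' \in F -> k = k'.
Proof.
move=> faceF kF k'F; rewrite diameter_orbit in k'F.
have kN := ltn_ord k; have k'N := ltn_ord k'.
have := face_not_between faceF kF k'N _ k'F.
by move=> h; apply: val_inj; rewrite /=; move: h; lia.
Qed.

(* Take the diameter through an endpoint of a longest B-diagonal of F: a
   B-diagonal crossing this diameter crosses the longest one or is longer. *)
Lemma facet_has_diameter F : (0 < n)%N -> facet R F -> exists k, diameterB k \in F.
Proof.
move=> n_gt0 [[diagF ncF] maxF].
(* By maximality, a diameter crossing no member of [F] already belongs to [F]. *)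
suff [k kF] : exists k, forall E, E \in F -> diameterB k != E ->
    ~ crossing R (diameterB k) E.
  exists k; rewrite -(maxF (diameterB k |: F)%SET) ?finset.subsetUr ?setU11 //.
  split=> [D /setU1P[->|/diagF //]|D E].
    by exists (ord_pred k, k); exact: B_arrow_diameter.
  move=> /setU1P[->|DF] /setU1P[->|EF]; rewrite ?eqxx //.
  - exact: kF.
  - by rewrite eq_sym => /(kF _ DF) nc /crossing_sym.
  - exact: ncF.
pose length_in m := exists r s, [/\ (r < N)%N, (r.+1 < s <= r + N)%N,
  pair_orbit r s \in F & m = (s - r)%N].
have orbitF E : E \in F -> exists r s, [/\ (r < N)%N, (r.+1 < s <= r + N)%N,
    E = pair_orbit r s & length_in (s - r)%N].
  move=> EF; have [a aE] := diagF _ EF.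
  have [r [s [rN rs E_rs _]]] := B_arrow_orbit n_gt0 aE.
  by exists r, s; split=> //; exists r, s; split=> //; rewrite -E_rs.
have [F0|[E0 E0F]] := set_0Vmem F.
  by exists ord0 => E; rewrite F0 inE.
have ex_length : exists m, `[< length_in m >].
  by have [r [s [_ _ _ ?]]] := orbitF _ E0F; exists (s - r)%N; exact/asboolP.
have length_le m : `[< length_in m >] -> (m <= N)%N.
  by move/asboolP => [r [s [? ? _ ->]]]; lia.
have [m /asboolP[p [q [pN pq pqF mE]]] m_max] := ex_maxnP ex_length length_le.
exists (Ordinal pN) => E EF neq.
have [r [s [rN rs E_rs /asboolP/m_max sr_max]]] := orbitF _ EF.
rewrite E_rs in neq EF *; apply: diameter_not_crossing => //=; first lia.
apply/negP => bet; have [eq_pq|neq_pq] := eqVneq (@pair_orbit n p q) (pair_orbit r s).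
  by move: bet; apply/negP; apply: (orbit_endpoint_not_between pN rN _ eq_pq); lia.
apply: (ncF _ _ EF pqF); first by rewrite eq_sym.
have rsE : [set @nat_vertex n r; @nat_vertex n s]%SET \in pair_orbit r s.
  by rewrite !inE eqxx.
(* Since [s - r <= q - p], [r < p] gives [s < q], and [r < p + N] gives [s < q + N]; so the
   endpoints alternate. *)
case/orP: bet => /andP[rp ps].
- apply: (alternating_crossing (d := q) rp ps _ _ rsE); [lia|lia|].
  by rewrite !inE eqxx.
- apply: (alternating_crossing (d := q + N) rp ps _ _ rsE); [lia|lia|].
  by rewrite !inE eqxx orbT.
Qed.

Lemma face_arrow_simplex_sub F k : (0 < n)%N -> face R F -> diameterB k \in F ->
  subset (arrow_simplex R F) (rotated_P_plus R k).
Proof.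
move=> n_gt0 faceF kF; apply: convex_hull_sub; first exact: rotated_P_plus_convex.
move=> _ [a [D DF Da] <-].
have [r [s [rN rs D_rs ->]]] := B_arrow_orbit n_gt0 Da.
rewrite D_rs in DF; have kN := ltn_ord k.
have rs' : (r < s <= r + N)%N by lia.
have nbet := face_not_between faceF kF rN rs' DF.
(* Adding [c] makes subtraction of [k] exact; [r + c - k] and [s.-1 + c - k] are the preimages of
   head and tail under the rotation. *)
pose c := if (k <= r)%N then 0%N else N.
have iN : (r + c - k < N)%N by rewrite /c; case: (leqP k r); lia.
have jN : (s.-1 + c - k < N)%N by rewrite /c; case: (leqP k r); move: nbet; lia.
have kc : (k <= r + c)%N by rewrite /c; case: (leqP k r); lia.
have modc i : ((i + c) %% N = i %% N)%N.
  by rewrite /c; case: (leqP k r) => _; rewrite ?addn0 ?modnDr.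
have -> : inord r = (zeta n ^+ k)%g (Ordinal iN).
  apply: val_inj; rewrite /= zetaXE /= subnK // modc modn_small //.
  by rewrite inordK.
have -> : inord (s.-1 %% N) = (zeta n ^+ k)%g (Ordinal jN).
  apply: val_inj; rewrite /= zetaXE /= subnK ?modc; last by lia.
  by rewrite inordK ?ltn_pmod.
(* The order is strict because [r.+1 < s]. *)
by apply: arrow_in_rotated_P_plus => /=; lia.
Qed.

(** The rotation commutes with [zeta], so the preimages satisfy [i = zeta n j]. With [i <= j] this
    forces the wrap-around [i = 0], whose image is [k]. *)
Lemma rotated_P_plus_diameter_arrow k k' :
  rotated_P_plus R k (arrow_point R (ord_pred k', k')) -> k = k'.
Proof.
set z := (zeta n ^+ k)%g; pose i := (z^-1)%g k'; pose j := (z^-1)%g (ord_pred k').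
have ziE : z i = k' by rewrite permKV.
have zjE : z j = ord_pred k' by rewrite permKV.
rewrite -{2}ziE -zjE => /arrow_of_rotated_P_plus ij.
have ijE : i = zeta n j.
  have zC : (zeta n * z)%g = (z * zeta n)%g by exact/commuteX/commute_refl.
  by apply: (@perm_inj _ z); rewrite ziE -permM zC permM zjE permE ord_predK.
have i0 : (i = 0 :> nat)%N.
  move: ij; rewrite ijE permE /=; have := ltn_ord j.
  rewrite ltnS leq_eqVlt => /orP[/eqP->|jn]; first by rewrite modnn.
  by rewrite modn_small ?ltnn // ltnS.
by apply: val_inj; rewrite -ziE [RHS]zetaXE i0 add0n modn_small.
Qed.

End Facets.

Theorem theorem7p2 (R : realType) (n : nat) (F : {set chord_orbit n})
    (n_ge1 : (1 <= n)%N) (facetF : facet R F) :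
  [/\ exists! k : 'I_n.+1, diameterB k \in F,
      forall k : 'I_n.+1, diameterB k \in F ->
        arrows_of F (ord_pred k, k) /\
        subset (arrow_simplex R F) (rotated_P_plus R k)
    & forall k : 'I_n.+1,
        subset (arrow_simplex R F) (rotated_P_plus R k) <-> diameterB k \in F].
Proof.
have [k0 k0F] := facet_has_diameter n_ge1 facetF; have faceF := facetF.1.
have arrowF k : diameterB k \in F -> arrows_of F (ord_pred k, k).
  by move=> kF; exists (diameterB k) => //; exact: B_arrow_diameter.
split.
- by exists k0; split=> // k; exact: (face_diameter_unique faceF k0F).
- by move=> k kF; split; [exact: arrowF|exact: face_arrow_simplex_sub].
- move=> k; split=> [sub|]; last exact: face_arrow_simplex_sub.
  (* The simplex contains the arrow of its own diameter [k0], which only the rotation by [k0]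
     admits. *)
  rewrite (_ : k = k0) //; apply/rotated_P_plus_diameter_arrow/sub.
  by apply: sub_convex_hull; exists (ord_pred k0, k0) => //; exact: arrowF.
Qed.
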